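(* Let $(X,\pi)$ be a weighted $n$-partite simplicial complex and let $\vec s=(s(1),\dots,s(n))$ be any ordering of $[n]$. For $A\subseteq[n]$ write $s(A)=\{s(a):a\in A\}$. Then \[\sigma_2\big(P_{\mathrm{sq}}^{(\vec s)}\big)^2\le 1-\prod_{j=2}^n\Big(1-\big(\varepsilon^{s([j-1])\to s(j)}\big)^2\Big),\] equivalently \[\mathrm{Gap}\big(P_{\mathrm{sq}}^{(\vec s)}\big)\ge 1-\sqrt{1-\prod_{j=2}^n\Big(1-\big(\varepsilon^{s([j-1])\to s(j)}\big)^2\Big)}.\] In particular, if $\pi$ is $\vec\varepsilon$-product for $\vec\varepsilon=(\varepsilon_0,\dots,\varepsilon_{n-2})$, then \[\sigma_2\big(P_{\mathrm{sq}}^{(\vec s)}\big)^2\le 1-\prod_{j=2}^n\prod_{p=0}^{j-2}\big(1-\varepsilon_{n-j+p}^2\big),\qquad \mathrm{Gap}\big(P_{\mathrm{sq}}^{(\vec s)}\big)\ge 1-\sqrt{1-\prod_{j=2}^n\prod_{p=0}^{j-2}\big(1-\varepsilon_{n-j+p}^2\big)}.\]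
   Context: An $n$-partite simplicial complex $X$ is a downward-closed family of subsets of a finite vertex set, all of whose inclusion-maximal faces have size $n$, together with a partition of the vertices into sides $X[1],\dots,X[n]$ such that every face $\omega$ of size $n$ (the set of these is $X^{(n)}$) contains exactly one vertex $\omega_i\in X[i]$ for each $i$. For a face $\alpha$, $\mathrm{typ}(\alpha)=\{i:\alpha\cap X[i]\neq\emptyset\}$; for $T\subseteq[n]$, $X[T]$ is the set of faces of type $T$; for $\omega\in X^{(n)}$, $\omega_T=\{\omega_t:t\in T\}$; $\alpha\oplus\beta$ denotes the union of faces of disjoint types; $|\alpha|$ is the number of vertices of $\alpha$. $X$ is weighted by a probability distribution $\pi$ on $X^{(n)}$ with full support. For $T\subseteq[n]$, the marginal $\pi_T$ on $X[T]$ is $\pi_T(\tau)=\sum_{\omega\supseteq\tau}\pi(\omega)$. For a face $\alpha$ of type $S$ and $T\subseteq[n]\setminus S$, $X_\alpha[T]=\{\tau\in X[T]:\alpha\oplus\tau\in X\}$ and $\pi^{(\alpha)}_T(\tau)=\Pr_{\omega\sim\pi}[\omega_T=\tau\mid \omega_S=\alpha]$. Inner products are $\langle f,g\rangle_\mu=\sum_x\mu(x)f(x)g(x)$. For a row-stochastic matrix $B\in\mathbb R^{A\times B'}$ with $\mu_AB=\mu_{B'}$, $\sigma_2(B)=\max\{\langle f,Bg\rangle_{\mu_A}:\|f\|_{\mu_A}=\|g\|_{\mu_{B'}}=1,\ \langle f,\mathbf 1\rangle_{\mu_A}=\langle g,\mathbf 1\rangle_{\mu_{B'}}=0\}$. Update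 operators $Q_i\in\mathbb R^{X^{(n)}\times X^{(n)}}$: $Q_i(\omega,\omega')=\pi^{(\omega_{[n]\setminus\{i\}})}_{\{i\}}(\omega'_i)$ if $\omega'_{[n]\setminus\{i\}}=\omega_{[n]\setminus\{i\}}$ and $0$ otherwise. The sequential sweep is $P_{\mathrm{sq}}^{(\vec s)}=Q_{s(1)}Q_{s(2)}\cdots Q_{s(n)}$; it has stationary distribution $\pi$, $\sigma_2$ is taken with respect to $\pi$ on both sides, and $\mathrm{Gap}(P)=1-\sigma_2(P)$. For a face $\alpha$ and disjoint $I,J\subseteq[n]\setminus\mathrm{typ}(\alpha)$, the colored walk $C^{I\to J}_\alpha\in\mathbb R^{X_\alpha[I]\times X_\alpha[J]}$ is $C^{I\to J}_\alpha(\tau_I,\tau_J)=\pi^{(\alpha\oplus\tau_I)}_J(\tau_J)$; it satisfies $\pi^{(\alpha)}_IC^{I\to J}_\alpha=\pi^{(\alpha)}_J$ and $\sigma_2$ is taken w.r.t. these. For disjoint $I,J\subseteq[n]$, $\varepsilon^{I\to J}=\max_{\alpha\in X[[n]\setminus(I\cup J)]}\sigma_2(C^{I\to J}_\alpha)$ (singletons written without braces). $\pi$ is $\vec\varepsilon$-product if $\sigma_2(C^{\{i\}\to\{j\}}_\alpha)\le\varepsilon_{|\alpha|}$ for every face $\alpha$ with $|\alpha|\le n-2$ and all distinct $i,j\in[n]\setminus\mathrm{typ}(\alpha)$.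
   Formalization: In the ε-product part it is additionally assumed that ε_k ≤ 1 for 0 ≤ k ≤ n−2; without this the bound fails, e.g. for n = 4 and all ε_k = 100, where the right-hand side is negative. *)

(* Defs.v *)
From HB Require Import structures.
From mathcomp Require Import all_boot all_order all_fingroup all_algebra.
From mathcomp Require Import classical_sets reals.

Set Implicit Arguments.
Unset Strict Implicit.
Unset Printing Implicit Defensive.

Import Order.TTheory GRing.Theory Num.Theory.
Local Open Scope ring_scope.

(* The partition of the vertices into sides is the map [side]: the side X[i]
   is its fibre over i. *)
Record partiteComplex (V : finType) (n : nat) := PartiteComplex {
  faces : {set {set V}};
  side : V -> 'I_n;
  faces_down : forall a b : {set V},
    b \in faces -> a \subset b -> a \in faces;
  faces_pure : forall a : {set V},
    maxset (fun b : {set V} => b \in faces) a -> #|a| = n;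
  faces_partite : forall w : {set V}, w \in faces -> #|w| = n ->
    forall i : 'I_n, #|[set v in w | side v == i]| = 1%N
}.

Section Complex.
Variables (V : finType) (n : nat) (X : partiteComplex V n).

Definition facets : {set {set V}} := [set w in faces X | #|w| == n].

Definition typ (a : {set V}) : {set 'I_n} := [set side X v | v in a].

Definition faces_typ (T : {set 'I_n}) : {set {set V}} :=
  [set a in faces X | typ a == T].

Definition restr (w : {set V}) (T : {set 'I_n}) : {set V} :=
  [set v in w | side X v \in T].

(* X_a[T], meant for T disjoint from the type of the face a. *)
Definition link (a : {set V}) (T : {set 'I_n}) : {set {set V}} :=
  [set t in faces_typ T | a :|: t \in faces X].

End Complex.

Section Sigma2.
Variable R : realType.

Definition inner (m : nat) (mu f g : 'cV[R]_m) : R :=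
  \sum_(i < m) mu i 0 * f i 0 * g i 0.

Definition wnorm (m : nat) (mu f : 'cV[R]_m) : R := Num.sqrt (inner mu f f).

(* The supremum is a maximum (continuity on a compact set) when mu and nu are
   positive and the set is nonempty. It is empty when one of the two index sets
   is a singleton, and then sigma2 is sup of the empty set, which is 0. *)
Definition sigma2 (m k : nat) (mu : 'cV[R]_m) (nu : 'cV[R]_k)
    (B : 'M[R]_(m, k)) : R :=
  sup [set x : R | exists (f : 'cV[R]_m) (g : 'cV[R]_k),
         [/\ wnorm mu f = 1, wnorm nu g = 1,
             inner mu f (const_mx 1) = 0, inner nu g (const_mx 1) = 0
           & x = inner mu f (B *m g)]]%classic.

End Sigma2.

(* Matrices indexed by finite sets of faces A and B are matrices of dimensions
   #|A| and #|B|, the i-th element of A being [enum_val i]. *)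
Section Walks.
Variables (R : realType) (V : finType) (n : nat) (X : partiteComplex V n).

(* Only the values of pi on the facets are ever used. *)
Definition is_weight (pi : {set V} -> R) : Prop :=
  (forall w, w \in facets X -> 0 < pi w) /\ \sum_(w in facets X) pi w = 1.

Variable pi : {set V} -> R.

Definition prob (E : pred {set V}) : R := \sum_(w in facets X | E w) pi w.

(* pi^(a)_T (t) = Pr[w_T = t | w_S = a], with S the type of a. *)
Definition cond_marginal (a : {set V}) (T : {set 'I_n}) (t : {set V}) : R :=
  prob (fun w => (restr X w T == t) && (restr X w (typ X a) == a))
  / prob (fun w => restr X w (typ X a) == a).

Definition facet_distr : 'cV[R]_#|facets X| := \col_i pi (enum_val i).

Definition link_distr (a : {set V}) (T : {set 'I_n}) : 'cV[R]_#|link X a T| :=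
  \col_i cond_marginal a T (enum_val i).

Definition update_entry (i : 'I_n) (w w' : {set V}) : R :=
  if restr X w' (~: [set i]) == restr X w (~: [set i])
  then cond_marginal (restr X w (~: [set i])) [set i] (restr X w' [set i])
  else 0.

Definition update (i : 'I_n) : 'M[R]_#|facets X| :=
  \matrix_(a, b) update_entry i (enum_val a) (enum_val b).

(* [\big] multiplies from left to right, so that the update of coordinate s 0
   is the leftmost factor. *)
Definition sweep (s : {perm 'I_n}) : 'M[R]_#|facets X| :=
  \big[mulmx/1%:M]_(k < n) update (s k).

Definition sigma2_facets (P : 'M[R]_#|facets X|) : R :=
  sigma2 facet_distr facet_distr P.

Definition Gap (P : 'M[R]_#|facets X|) : R := 1 - sigma2_facets P.

Definition colored_walk (a : {set V}) (I J : {set 'I_n}) :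
    'M[R]_(#|link X a I|, #|link X a J|) :=
  \matrix_(t, u) cond_marginal (a :|: enum_val t) J (enum_val u).

Definition sigma2_walk (a : {set V}) (I J : {set 'I_n}) : R :=
  sigma2 (link_distr a I) (link_distr a J) (colored_walk a I J).

(* The default value 0 of the maximum is harmless: sigma2 is nonnegative. *)
Definition eps_walk (I J : {set 'I_n}) : R :=
  \big[Num.max/0]_(a in faces_typ X (~: (I :|: J))) sigma2_walk a I J.

(* The vector (eps_0, ..., eps_(n-2)) is a sequence of reals of which only
   these entries matter. *)
Definition eps_product (eps : nat -> R) : Prop :=
  forall (a : {set V}) (i j : 'I_n),
    a \in faces X -> (#|a|.+2 <= n)%N -> i != j ->
    i \notin typ X a -> j \notin typ X a ->
    sigma2_walk a [set i] [set j] <= eps #|a|.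

End Walks.

(* With positions counted from 0, the image under s of the positions before
   k; for k = j - 1 this is s([j-1]), and s k is s(j). *)
Definition before (n : nat) (s : {perm 'I_n}) (k : 'I_n) : {set 'I_n} :=
  [set s a | a : 'I_n & (a < k)%N].

(* Main.v *)
Require Import Defs.
From HB Require Import structures.
From mathcomp Require Import all_boot all_order all_fingroup all_algebra.
From mathcomp Require Import classical_sets reals.
From mathcomp Require boolp.
From mathcomp Require Import ring lra.
From mathcomp Require Import fintype finset.

Set Implicit Arguments.
Unset Strict Implicit.
Unset Printing Implicit Defensive.

Import Order.TTheory GRing.Theory Num.Theory.
Local Open Scope ring_scope.

(** Each update Q_i is the conditional expectation given all coordinates except
    i, so the sweep is a product of projections. The argument of Smith, Solmon
    and Wagner bounds its norm on mean-zero functions by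
    1 - prod_j (1 - c_j^2), where c_j is the cosine of the angle, relative to
    the functions of the coordinates outside s([j]), between the functions not
    depending on s([j-1]) and those not depending on s(j). Conditioning on the
    coordinates outside s([j]), this cosine is at most the second singular value
    of the colored walk in the link.

    For the product bound, the coordinates of s([j-1]) are revealed one at a
    time: by the law of total variance each of them leaves at least a fraction
    1 - eps_k^2 of the conditional variance of a function of the coordinate
    s(j), where k is the number of coordinates already fixed. *)

(** Lets [big_ord_recr] peel the last factor off the matrix product of the sweep, whose dimension is
    not of the form [m.+1]. *)
HB.instance Definition _ (R : pzRingType) (m : nat) :=
  Monoid.isLaw.Build 'M[R]_m 1%:M mulmx
    (@mulmxA R m m m m) (@mul1mx R m m) (@mulmx1 R m m).

(** * Inner products and second singular values *)

Section Inner.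
Variables (R : realType) (m : nat) (mu : 'cV[R]_m).
Implicit Types f g h : 'cV[R]_m.

Lemma innerC f g : inner mu f g = inner mu g f.
Proof. by apply: eq_bigr => i _; rewrite mulrAC. Qed.

Lemma innerDl f g h : inner mu (f + g) h = inner mu f h + inner mu g h.
Proof.
by rewrite -big_split; apply: eq_bigr => i _ /=; rewrite mxE; ring.
Qed.

Lemma innerZl c f h : inner mu (c *: f) h = c * inner mu f h.
Proof. by rewrite mulr_sumr; apply: eq_bigr => i _ /=; rewrite mxE; ring. Qed.

Lemma innerNl f h : inner mu (- f) h = - inner mu f h.
Proof. by rewrite -scaleN1r innerZl mulN1r. Qed.

Lemma innerBl f g h : inner mu (f - g) h = inner mu f h - inner mu g h.
Proof. by rewrite innerDl innerNl. Qed.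

Lemma innerZr c f h : inner mu f (c *: h) = c * inner mu f h.
Proof. by rewrite innerC innerZl innerC. Qed.

Lemma innerNr f h : inner mu f (- h) = - inner mu f h.
Proof. by rewrite innerC innerNl innerC. Qed.

Lemma innerBr f g h : inner mu h (f - g) = inner mu h f - inner mu h g.
Proof. by rewrite innerC innerBl ![inner mu h _]innerC. Qed.

Lemma wnormZ c f : wnorm mu (c *: f) = `|c| * wnorm mu f.
Proof.
by rewrite /wnorm innerZl innerZr mulrA -expr2 sqrtrM ?sqr_ge0// sqrtr_sqr.
Qed.

Hypothesis mu_ge0 : forall i, 0 <= mu i 0.

Lemma inner_ge0 f : 0 <= inner mu f f.
Proof.
by apply: sumr_ge0 => i _; rewrite -mulrA mulr_ge0// -expr2 sqr_ge0.
Qed.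

Lemma sqr_wnorm f : wnorm mu f ^+ 2 = inner mu f f.
Proof. by rewrite sqr_sqrtr// inner_ge0. Qed.

(** The weights are only nonnegative, as for a measure carried by one fibre, so a nonzero [g] may
    have norm zero; then every product of weight and value of [g] vanishes. Otherwise expand the
    squared norm of [inner mu g g *: f - inner mu f g *: g]. *)
Lemma inner_CS f g : inner mu f g ^+ 2 <= inner mu f f * inner mu g g.
Proof.
have [g0|g_neq0] := eqVneq (inner mu g g) 0; last first.
  have gp : 0 < inner mu g g by rewrite lt_def g_neq0 inner_ge0.
  have := inner_ge0 (inner mu g g *: f - inner mu f g *: g).
  rewrite !(innerBl, innerBr, innerZl, innerZr) (innerC g f) => H.
  rewrite -subr_ge0 -(pmulr_rge0 _ gp).
  by congr (0 <= _): H; ring.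
suff -> : inner mu f g = 0 by rewrite g0 mulr0 expr0n.
rewrite [LHS]big1// => i _.
have/eqP := g0; rewrite psumr_eq0 => [/allP/(_ i)|j _]; last first.
  by rewrite -mulrA mulr_ge0// -expr2 sqr_ge0.
rewrite mem_index_enum => /(_ isT)/=; rewrite !mulf_eq0 -orbA orbb.
by case/orP => /eqP ->; rewrite ?mulr0 ?mul0r.
Qed.

Lemma inner_le_wnorm f g : inner mu f g <= wnorm mu f * wnorm mu g.
Proof.
rewrite (le_trans (ler_norm _))// -ler_sqr ?nnegrE ?mulr_ge0 ?sqrtr_ge0//.
by rewrite real_normK ?num_real// exprMn !sqr_wnorm inner_CS.
Qed.

End Inner.

Section Sigma2Theory.
Variables (R : realType) (m k : nat) (mu : 'cV[R]_m) (nu : 'cV[R]_k).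
Variable B : 'M[R]_(m, k).

(** The set of values is stable under negation, through [f] replaced by [- f], so its supremum
    bounds both some [x] and [- x]. If the set is empty or unbounded, [sup] is 0 by default. *)
Lemma sigma2_ge0 : 0 <= sigma2 mu nu B.
Proof.
rewrite /sigma2; set A := (X in sup X).
have [supA|/sup_out->//] := boolp.EM (has_sup A).
have [[x Ax] ubA] := supA.
have xle := ub_le_sup ubA Ax.
have ANx : A (- x).
  case: Ax => f [g [f1 g1 f0 g0 ->]]; exists (- f), g; split=> //.
  - by rewrite /wnorm innerNl innerNr opprK.
  - by rewrite innerNl f0 oppr0.
  - by rewrite innerNl.
have := ub_le_sup ubA ANx; lra.
Qed.

Variable c : R.
Hypothesis inner_le : forall f g,
  inner mu f (const_mx 1) = 0 -> inner nu g (const_mx 1) = 0 ->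
  inner mu f (B *m g) <= c * wnorm mu f * wnorm nu g.

(** Rescale both vectors to norm 1. The a priori bound [c] makes the set bounded, so that [sup]
    really is an upper bound. *)
Lemma inner_le_sigma2 f g :
  inner mu f (const_mx 1) = 0 -> inner nu g (const_mx 1) = 0 ->
  wnorm mu f != 0 -> wnorm nu g != 0 ->
  inner mu f (B *m g) <= sigma2 mu nu B * wnorm mu f * wnorm nu g.
Proof.
move=> f1 g1 f0 g0.
have fp : 0 < wnorm mu f by rewrite lt_def f0 sqrtr_ge0.
have gp : 0 < wnorm nu g by rewrite lt_def g0 sqrtr_ge0.
rewrite -mulrA mulrC -ler_pdivrMl ?mulr_gt0//.
apply: ub_le_sup.
  exists c => _ [f' [g' [f'1 g'1 f'0 g'0 ->]]].
  by have := inner_le f'0 g'0; rewrite f'1 g'1 !mulr1.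
exists ((wnorm mu f)^-1 *: f), ((wnorm nu g)^-1 *: g); split.
- by rewrite wnormZ gtr0_norm ?invr_gt0// mulVf.
- by rewrite wnormZ gtr0_norm ?invr_gt0// mulVf.
- by rewrite innerZl f1 mulr0.
- by rewrite innerZl g1 mulr0.
- by rewrite -scalemxAr innerZl innerZr invfM mulrA.
Qed.

(** The sign of [c] matters when there is no admissible pair, since [sup] is then 0. *)
Lemma sigma2_le : 0 <= c -> sigma2 mu nu B <= c.
Proof.
move=> c0; rewrite /sigma2; set A := (X in sup X).
have [A0|A0] := boolp.EM (nonempty A); last by rewrite sup_out// => -[].
apply: ge_sup => // _ [f [g [f1 g1 f0 g0 ->]]].
by have := inner_le f0 g0; rewrite f1 g1 !mulr1.
Qed.

End Sigma2Theory.

(** * Conditional expectations and products of projections *)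

Section CondExp.
Variables (R : realType) (N : nat) (mu : 'cV[R]_N).
Hypothesis mu_gt0 : forall i, 0 < mu i 0.
Implicit Types f g h : 'cV[R]_N.

(** The key [kap] stands for the finite sigma-algebra whose atoms are its fibres. *)
Definition measurable_for (K : eqType) (kap : 'I_N -> K) f :=
  forall i j, kap i = kap j -> f i 0 = f j 0.

Definition condexp (K : eqType) (kap : 'I_N -> K) f : 'cV[R]_N :=
  \col_i ((\sum_(j | kap j == kap i) mu j 0 * f j 0)
          / \sum_(j | kap j == kap i) mu j 0).

Let mu_ge0 i : 0 <= mu i 0. Proof. exact: ltW. Qed.

Section OneKey.
Variables (K : eqType) (kap : 'I_N -> K).

Lemma condexpB f g : condexp kap (f - g) = condexp kap f - condexp kap g.
Proof.
apply/colP => i; rewrite !mxE -mulrBl -sumrB; congr (_ / _).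
by apply: eq_bigr => j _; rewrite !mxE mulrBr.
Qed.

Lemma fibre_mass_gt0 i : 0 < \sum_(j | kap j == kap i) mu j 0.
Proof. by rewrite (bigD1 i)//= ltr_wpDr// sumr_ge0. Qed.

Lemma measurable_condexp f : measurable_for kap (condexp kap f).
Proof. by move=> i j e; rewrite !mxE e. Qed.

Lemma condexp_id f : measurable_for kap f -> condexp kap f = f.
Proof.
move=> mf; apply/colP => i; rewrite mxE.
rewrite (eq_bigr (fun j => mu j 0 * f i 0)); last first.
  by move=> j /eqP/mf ->.
by rewrite -mulr_suml mulrAC mulfV ?mul1r// gt_eqF ?fibre_mass_gt0.
Qed.

(** Averaging over blocks has a symmetric kernel with respect to [mu]: exchange the two sums and
    move [g] from one point of a block to another. *)
Lemma inner_condexp g f : measurable_for kap g ->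
  inner mu g (condexp kap f) = inner mu g f.
Proof.
move=> mg; rewrite /inner.
under eq_bigr => i _ do rewrite mxE mulr_suml mulr_sumr.
rewrite (exchange_big_dep predT)//=; apply: eq_bigr => j _.
have H i : kap j == kap i ->
    mu i 0 * g i 0 * (mu j 0 * f j 0 / (\sum_(l | kap l == kap i) mu l 0))
    = mu i 0 * (mu j 0 * g j 0 * f j 0 / (\sum_(l | kap l == kap j) mu l 0)).
  by move=> /eqP e; rewrite e (mg _ _ e); ring.
rewrite (eq_bigr _ H) -mulr_suml.
rewrite (eq_bigl (fun i => kap i == kap j)); last by move=> i; rewrite eq_sym.
by rewrite mulrC mulfVK// gt_eqF ?fibre_mass_gt0.
Qed.

Lemma inner_condexp_self f :
  inner mu (condexp kap f) (condexp kap f) = inner mu (condexp kap f) f.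
Proof. exact/inner_condexp/measurable_condexp. Qed.

Lemma condexp_pythagoras f :
  inner mu f f = inner mu (condexp kap f) (condexp kap f)
    + inner mu (f - condexp kap f) (f - condexp kap f).
Proof.
rewrite !(innerBl, innerBr) [inner mu f (condexp _ _)]innerC.
by rewrite inner_condexp_self; ring.
Qed.

Lemma condexp_contraction f :
  inner mu (condexp kap f) (condexp kap f) <= inner mu f f.
Proof. by rewrite [leRHS]condexp_pythagoras lerDl inner_ge0. Qed.

Lemma inner_eq0 f : inner mu f f = 0 -> f = 0.
Proof.
move=> /eqP; rewrite psumr_eq0 => [/allP f0|j _]; last first.
  by rewrite -mulrA mulr_ge0// -expr2 sqr_ge0.
apply/colP => i; have := f0 i; rewrite mem_index_enum => /(_ isT)/=.
by rewrite !mulf_eq0 gt_eqF//= orbb mxE => /eqP.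
Qed.

(** The difference of the two candidates is measurable and orthogonal to every measurable function,
    hence to itself. *)
Lemma condexp_unique f h : measurable_for kap h ->
  (forall g, measurable_for kap g -> inner mu g h = inner mu g f) ->
  condexp kap f = h.
Proof.
move=> mh H; apply/eqP; rewrite -subr_eq0; apply/eqP/inner_eq0.
have mD : measurable_for kap (condexp kap f - h).
  by move=> i j e; rewrite !mxE e (mh _ _ e).
by rewrite innerBr (H _ mD) (inner_condexp _ mD) subrr.
Qed.

End OneKey.

Section TwoKeys.
Variables (K K' : eqType) (kap : 'I_N -> K) (kap' : 'I_N -> K').
Hypothesis coarser : forall i j, kap' i = kap' j -> kap i = kap j.

Lemma measurable_coarser f : measurable_for kap f -> measurable_for kap' f.
Proof. by move=> mf i j /coarser /mf. Qed.

Lemma condexp_tower f : condexp kap (condexp kap' f) = condexp kap f.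
Proof.
symmetry; apply: condexp_unique; first exact: measurable_condexp.
by move=> g mg; rewrite !inner_condexp//; apply: measurable_coarser.
Qed.

Lemma condexp_finer f : condexp kap' (condexp kap f) = condexp kap f.
Proof. exact/condexp_id/measurable_coarser/measurable_condexp. Qed.

End TwoKeys.

(* The Smith-Solmon-Wagner bound for products of projections, with the subspaces
   [measurable_for (A k)] in the role of the successive intersections. *)
Lemma product_condexp_bound (n : nat) (K : eqType) (L A : nat -> 'I_N -> K)
    (Q : nat -> 'M[R]_N) (e : nat -> R) :
  (forall k f, (k < n)%N -> Q k *m f = condexp (L k) f) ->
  injective (A 0) ->
  (forall k i j, (k < n)%N -> A k i = A k j -> A k.+1 i = A k.+1 j) ->
  (forall k i j, (k < n)%N -> L k i = L k j -> A k.+1 i = A k.+1 j) ->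
  (forall k, (k < n)%N -> 0 <= e k <= 1) ->
  (forall k g, (k < n)%N -> measurable_for (L k) g -> condexp (A k.+1) g = 0 ->
     inner mu (condexp (A k) g) (condexp (A k) g) <= (1 - e k) * inner mu g g) ->
  forall f, condexp (A n) f = 0 ->
  let Pf := (\big[mulmx/1%:M]_(k < n) Q k) *m f in
  inner mu Pf Pf <= (1 - \prod_(k < n) e k) * inner mu f f.
Proof.
move=> QE A0 AS LA e01 Hang f Af /=.
pose P m := \big[mulmx/1%:M]_(k < m) Q k.
have PS m g : P m.+1 *m g = P m *m (Q m *m g).
  by rewrite /P big_ord_recr/= mulmxA.
(* Each key [L k] with [k < m] refines [A m], so the factors of [P m] fix the functions measurable
   for [A m], and averaging over the blocks of [A m] absorbs them ([AP]). *)
have fixP m g : (m <= n)%N -> P m *m condexp (A m) g = condexp (A m) g.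
  elim: m g => [|m IH] g mn; first by rewrite /P big_ord0 mul1mx.
  rewrite PS QE// condexp_finer; last by move=> i j; exact: LA.
  rewrite -(condexp_finer (kap' := A m)) ?IH//; first exact: ltnW.
  by move=> i j; exact: AS.
have AP m g : (m <= n)%N -> condexp (A m) (P m *m g) = condexp (A m) g.
  elim: m g => [|m IH] g mn; first by rewrite /P big_ord0 mul1mx.
  rewrite PS QE// -(condexp_tower (kap' := A m)); last by move=> i j; exact: AS.
  rewrite IH ?(ltnW mn)// condexp_tower; last by move=> i j; exact: AS.
  by rewrite condexp_tower// => i j; exact: LA.
pose p m := \prod_(k < m) e k.
have pS m : p m.+1 = p m * e m by rewrite /p big_ord_recr.
have p01 m : (m <= n)%N -> 0 <= p m <= 1.
  elim: m => [|m IH] mn; first by rewrite /p big_ord0 ler01 lexx.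
  have /andP[p0 p1] := IH (ltnW mn); have /andP[e0 e1] := e01 _ mn.
  by rewrite pS mulr_ge0//= mulr_ile1.
suff main m g : (m <= n)%N -> condexp (A m) g = 0 ->
    inner mu (P m *m g) (P m *m g) <= (1 - p m) * inner mu g g.
  exact: main.
(* In the base case [A 0] separates points, so [condexp (A 0)] is the identity and [g] is zero. *)
elim: m g => [|m IH] g mn Ag.
  suff -> : g = 0 by rewrite mulmx0 -[0]addr0 innerDl -(scale0r 0) !innerZl; lra.
  by rewrite -Ag condexp_id// => i j /A0 ->.
have mn' := ltnW mn.
(* [P m] fixes the part [a] of [h] and sends [h - a] to something orthogonal to [a], so the
   induction hypothesis is applied to [h - a] only. *)
rewrite PS QE//; set h := condexp (L m) g.
have hg : inner mu h h <= inner mu g g by exact: condexp_contraction.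
have Ah : condexp (A m.+1) h = 0.
  by rewrite /h condexp_tower// => i j; exact: LA.
have mh : measurable_for (L m) h by exact: measurable_condexp.
have := Hang _ _ mn mh Ah; set a := condexp (A m) h => ang.
have Ar : condexp (A m) (h - a) = 0.
  by rewrite condexpB [condexp _ a]condexp_id ?subrr//; apply: measurable_condexp.
have Ph : P m *m h = a + P m *m (h - a).
  by rewrite mulmxBr fixP// addrC subrK.
have orth : inner mu (P m *m (h - a)) a = 0.
  have ma : measurable_for (A m) a by exact: measurable_condexp.
  rewrite innerC -(inner_condexp _ ma) AP// Ar.
  by rewrite -(scale0r 0) innerZr mul0r.
have := IH _ mn' Ar.
have -> : inner mu (P m *m h) (P m *m h)
    = inner mu a a + inner mu (P m *m (h - a)) (P m *m (h - a)).
  by rewrite Ph innerDl ![inner mu _ (a + _)]innerC !innerDl orth (innerC _ a) orth;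
     ring.
have := condexp_pythagoras (A m) h; rewrite -/a.
have /andP[p0 p1] := p01 _ mn'; have /andP[e0 e1] := e01 _ mn.
rewrite pS; move: (inner mu (P m *m _) _) (inner mu (h - a) _) ang hg.
move: (inner mu a a) (inner_ge0 mu_ge0 h) => {Ph Ah mh Ar orth} aa.
move: (inner mu h h) (inner mu g g) => hh gg h0 x y H1 H2 H3 H4.
(* The squared norm is at most [(1 - p m) * hh + p m * aa], and the angle bound
   [aa <= (1 - e m) * hh] turns this into [(1 - p m * e m) * hh]. *)
have H5 : (1 - p m * e m) * hh <= (1 - p m * e m) * gg.
  by apply: ler_wpM2l => //; rewrite subr_ge0 mulr_ile1.
have H6 : p m * aa <= p m * ((1 - e m) * hh) by apply: ler_wpM2l.
nra.
Qed.

End CondExp.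

(** * Links and colored walks *)

Section Restriction.
Variables (V : finType) (n : nat) (X : partiteComplex V n).
Implicit Types (w a : {set V}) (S T : {set 'I_n}).

Lemma restrU w S T : restr X w (S :|: T) = restr X w S :|: restr X w T.
Proof. by apply/setP => v; rewrite !inE andb_orr. Qed.

Lemma restrI w S T : restr X (restr X w S) T = restr X w (S :&: T).
Proof. by apply/setP => v; rewrite !inE andbA. Qed.

Lemma restr_setT w : restr X w setT = w.
Proof. by apply/setP => v; rewrite !inE andbT. Qed.

Lemma restr_set0 w : restr X w set0 = set0.
Proof. by apply/setP => v; rewrite !inE andbF. Qed.

Lemma restr_sub w S : restr X w S \subset w.
Proof. by apply/subsetP => v; rewrite inE => /andP[]. Qed.

Lemma restr_typ a : restr X a (typ X a) = a.
Proof.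
by apply/setP => v; rewrite inE andb_idr// => va; apply: imset_f.
Qed.

Lemma typU a b : typ X (a :|: b) = typ X a :|: typ X b.
Proof. exact: imsetU. Qed.

Lemma restr_disjoint a S : [disjoint typ X a & S] -> restr X a S = set0.
Proof.
by move=> d; rewrite -{1}(restr_typ a) restrI disjoint_setI0// restr_set0.
Qed.

Lemma restr_coarser w w' S T : S \subset T ->
  restr X w T = restr X w' T -> restr X w S = restr X w' S.
Proof. by move=> /setIidPr ST e; rewrite -ST -!restrI e. Qed.

Lemma restr_union_eq w a t : [disjoint typ X a & typ X t] ->
  (restr X w (typ X (a :|: t)) == a :|: t)
  = (restr X w (typ X t) == t) && (restr X w (typ X a) == a).
Proof.
move=> d; rewrite typU restrU; apply/eqP/andP => [e|[/eqP-> /eqP->]//].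
have d' : [disjoint typ X t & typ X a] by rewrite disjoint_sym.
have rU b c S : restr X (b :|: c) S = restr X b S :|: restr X c S.
  by apply/setP => v; rewrite !inE andb_orl.
have restrE (b : {set V}) : b \subset a :|: t ->
    restr X w (typ X b) = restr X (a :|: t) (typ X b).
  move=> bs; rewrite -e -restrU restrI (setIidPr _)// -typU.
  exact: imsetS.
rewrite !restrE ?subsetUl ?subsetUr// !rU !restr_typ !restr_disjoint//.
by rewrite set0U setU0.
Qed.

Section Facet.
Variable w : {set V}.
Hypothesis wX : w \in facets X.

Lemma facet_face : w \in faces X.
Proof. by move: wX; rewrite inE => /andP[]. Qed.

Lemma restr_face S : restr X w S \in faces X.
Proof. exact: faces_down facet_face (restr_sub _ _). Qed.

Lemma side_card1 i : #|[set v in w | side X v == i]| = 1%N.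
Proof.
by apply: faces_partite; [exact: facet_face|move: wX; rewrite inE => /andP[_ /eqP]].
Qed.

Lemma typ_restr S : typ X (restr X w S) = S.
Proof.
apply/setP => i; apply/imsetP/idP => [[v]|iS]; first by rewrite inE => /andP[_ vS] ->.
have /eqP/cards1P[v /setP/(_ v)] := side_card1 i.
by rewrite !inE eqxx => /andP[vw /eqP vi]; exists v; rewrite // inE vw vi.
Qed.

(** A facet has a single vertex on each side, so [side] is injective on it. *)
Lemma card_restr S : #|restr X w S| = #|S|.
Proof.
rewrite -[in RHS](typ_restr S) card_in_imset// => u v.
rewrite !inE => /andP[uw _] /andP[vw _] uv.
have /eqP/cards1P[x e] := side_card1 (side X u).
have : u \in [set x] by rewrite -e inE uw eqxx.
have : v \in [set x] by rewrite -e inE vw uv eqxx.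
by rewrite !inE => /eqP-> /eqP->.
Qed.

Lemma restr_faces_typ S : restr X w S \in faces_typ X S.
Proof. by rewrite inE restr_face typ_restr eqxx. Qed.

Lemma restr_link S T : restr X w T \in link X (restr X w S) T.
Proof. by rewrite inE restr_faces_typ -restrU restr_face. Qed.

End Facet.
End Restriction.

(** Turns a vector indexed by positions in [A] into a function of faces, so that sums can be
    regrouped by face; the value 0 outside [A] is arbitrary. *)
Lemma cV_enum_val (R : nmodType) (T : finType) (A : {set T}) (f : 'cV[R]_#|A|) :
  exists F : T -> R, f = \col_i F (enum_val i).
Proof.
exists (fun t => if [pick i | enum_val i == t] is Some i then f i 0 else 0).
apply/colP => i; rewrite mxE; case: pickP => [j /eqP/enum_val_inj->//|/(_ i)].
by rewrite eqxx.
Qed.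

(** * Expectations in a link as sums over facets *)

Section LinkSums.
Variables (R : realType) (V : finType) (n : nat) (X : partiteComplex V n).
Variables (pi : {set V} -> R) (hpi : is_weight X pi).
Variables (w0 : {set V}) (S : {set 'I_n}).
Hypothesis w0X : w0 \in facets X.
Local Notation a := (restr X w0 S).
Local Notation fibre T w := (restr X w T == restr X w0 T).

Let typa : typ X a = S := typ_restr w0X S.

Lemma fibre_prob_gt0 : 0 < prob X pi (fun w => fibre S w).
Proof.
have [pi_gt0 _] := hpi.
rewrite /prob (bigD1 w0) ?w0X ?eqxx//= ltr_wpDr ?pi_gt0//.
by apply: sumr_ge0 => w /andP[/andP[wX _] _]; apply/ltW/pi_gt0.
Qed.

Lemma sum_link (T : {set 'I_n}) (F : {set V} -> R) :
  \sum_(t in link X a T) (\sum_(w in facets X | (restr X w T == t) && fibre S w)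
      pi w) * F t
  = \sum_(w in facets X | fibre S w) pi w * F (restr X w T).
Proof.
rewrite [RHS](partition_big (fun w => restr X w T) (mem (link X a T)))/=.
  apply: eq_bigr => t _; rewrite mulr_suml; apply: eq_big => [w|w].
    by rewrite -andbA [fibre S w && _]andbC.
  by case/and3P => _ /eqP->.
by move=> w /andP[wX /eqP <-]; apply: restr_link.
Qed.

Lemma link_expectation (T : {set 'I_n}) (F : {set V} -> R) :
  \sum_i link_distr X pi a T i 0 * F (enum_val i)
  = (\sum_(w in facets X | fibre S w) pi w * F (restr X w T))
    / prob X pi (fun w => fibre S w).
Proof.
rewrite -sum_link mulr_suml.
rewrite (eq_bigr (fun i => cond_marginal X pi a T (enum_val i) * F (enum_val i)));
  last by move=> i _; rewrite mxE.
rewrite -(big_enum_val (fun t => cond_marginal X pi a T t * F t)).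
by apply: eq_bigr => t _; rewrite mulrAC /cond_marginal typa.
Qed.

Lemma inner_link (T : {set 'I_n}) (F G : {set V} -> R) :
  inner (link_distr X pi a T) (\col_i F (enum_val i)) (\col_i G (enum_val i))
  = (\sum_(w in facets X | fibre S w) pi w * F (restr X w T) * G (restr X w T))
    / prob X pi (fun w => fibre S w).
Proof.
under [in RHS]eq_bigr do rewrite -mulrA.
rewrite -(link_expectation T (fun t => F t * G t)).
by apply: eq_bigr => i _; rewrite !mxE mulrA.
Qed.

(** The walk replaces [G] by its conditional expectation [num t / den] given the parts of type [S]
    and [I]; weighting by the marginal of [t] cancels [den] and leaves a joint expectation over the
    facets through [a]. *)
Lemma inner_colored_walk (I J : {set 'I_n}) (F G : {set V} -> R) :
  [disjoint S & I] ->
  inner (link_distr X pi a I) (\col_i F (enum_val i))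
    (colored_walk X pi a I J *m \col_j G (enum_val j))
  = (\sum_(w in facets X | fibre S w) pi w * F (restr X w I) * G (restr X w J))
    / prob X pi (fun w => fibre S w).
Proof.
move=> dSI.
have [pi_gt0 _] := hpi.
pose num t := \sum_(w in facets X | (restr X w I == t) && fibre S w)
  pi w * G (restr X w J).
transitivity (\sum_(t in link X a I)
    F t * (num t / prob X pi (fun w => fibre S w))); last first.
  rewrite [RHS]mulr_suml.
  rewrite [RHS](partition_big (fun w => restr X w I) (mem (link X a I)))/=;
    last by move=> w /andP[wX /eqP <-]; apply: restr_link.
  apply: eq_bigr => t _; rewrite mulrA mulr_sumr mulr_suml; apply: eq_big => [w|w].
    by rewrite -andbA [fibre S w && _]andbC.
  by case/and3P => _ /eqP-> _; ring.
rewrite /inner [RHS]big_enum_val/=; apply: eq_bigr => i _.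
rewrite !mxE (eq_bigr (fun j => cond_marginal X pi (a :|: enum_val i) J (enum_val j)
   * G (enum_val j))); last by move=> j _; rewrite !mxE.
have := enum_valP i; move: (enum_val i) => t tL.
have typt : typ X t = I by move: tL; rewrite !inE => /andP[/andP[_ /eqP]].
have dat : [disjoint typ X a & typ X t] by rewrite typa typt.
rewrite -(big_enum_val (fun u => cond_marginal X pi (a :|: t) J u * G u)) /=.
pose den := prob X pi (fun w => (restr X w I == t) && fibre S w).
have atE w : (restr X w (typ X (a :|: t)) == a :|: t)
    = (restr X w I == t) && fibre S w.
  by rewrite restr_union_eq// typa typt.
have -> : \sum_(u in link X a J) cond_marginal X pi (a :|: t) J u * G u
    = num t / den.
  have denE : prob X pi (fun w => restr X w (typ X (a :|: t)) == a :|: t) = den.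
    by rewrite /den /prob; apply: eq_bigl => w; rewrite atE.
  rewrite /num [X in _ = X / _](partition_big (fun w => restr X w J)
    (mem (link X a J)))/=;
    last by move=> w /and3P [wX _ /eqP <-]; apply: restr_link.
  rewrite mulr_suml; apply: eq_bigr => u _.
  rewrite /cond_marginal denE mulrAC /prob mulr_suml; congr (_ / _).
  apply: eq_big => [w|w]; first by rewrite atE -!andbA; do !bool_congr.
  by case/and3P => _ /eqP->.
have -> : cond_marginal X pi a I t = den / prob X pi (fun w => fibre S w).
  by rewrite /cond_marginal typa.
(* If [den] vanished, positivity of [pi] would leave no facet through both faces, and [num t] would
   be an empty sum. *)
have [den0|den_neq0] := eqVneq den 0; last first.
  by field; rewrite den_neq0 gt_eqF ?fibre_prob_gt0.
suff -> : num t = 0 by rewrite den0; ring.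
apply: big1 => w /andP[wX wt].
suff : pi w <= 0 by rewrite leNgt pi_gt0.
rewrite -den0 /den /prob (bigD1 w) ?wX//= lerDl sumr_ge0// => v /andP[/andP[vX _] _].
exact/ltW/pi_gt0.
Qed.

End LinkSums.

(** * Colored walks as conditional expectations *)

Section Walks.
Variables (R : realType) (V : finType) (n : nat) (X : partiteComplex V n).
Variables (pi : {set V} -> R) (hpi : is_weight X pi).
Implicit Types (S I J T : {set 'I_n}) (f g h : 'cV[R]_#|facets X|).
Local Notation N := #|facets X|.
Local Notation mu := (facet_distr X pi).

Definition facet_restr T (i : 'I_N) : {set V} := restr X (enum_val i) T.

Lemma facet_distr_gt0 i : 0 < mu i 0.
Proof. by rewrite mxE; apply: hpi.1; apply: enum_valP. Qed.

Let mu_gt0 := facet_distr_gt0.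
Let mu_ge0 i : 0 <= mu i 0 := ltW (mu_gt0 i).

Lemma facet_restr_coarser S T : S \subset T -> forall i j,
  facet_restr T i = facet_restr T j -> facet_restr S i = facet_restr S j.
Proof. by move=> ST i j; apply: restr_coarser. Qed.

Local Notation E T f := (condexp mu (facet_restr T) f).

(** The law conditioned on the face of type [S], left unnormalised and carried by all facets: the
    links of all faces then share one index set, at the price of the factor [mass] below. *)
Definition fibre_distr S (i0 : 'I_N) : 'cV[R]_N :=
  \col_i (if facet_restr S i == facet_restr S i0 then mu i 0 else 0).

(** Moves the indicator of the fibre from the weight to the function, so that [inner_condexp] for
    [mu] applies. *)
Definition fibre_part S i0 f : 'cV[R]_N :=
  \col_i (if facet_restr S i == facet_restr S i0 then f i 0 else 0).

Lemma fibre_distr_ge0 S i0 i : 0 <= fibre_distr S i0 i 0.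
Proof. by rewrite mxE; case: ifP. Qed.

Lemma inner_fibre S i0 f g :
  inner (fibre_distr S i0) f g = inner mu (fibre_part S i0 f) g.
Proof. by apply: eq_bigr => i _; rewrite !mxE; case: ifP => _; ring. Qed.

Lemma inner_fibreE S i0 f g :
  inner (fibre_distr S i0) f g
  = \sum_(i | facet_restr S i == facet_restr S i0) mu i 0 * f i 0 * g i 0.
Proof.
rewrite [RHS]big_mkcond; apply: eq_bigr => i _; rewrite mxE.
by case: ifP => _ //; rewrite !mul0r.
Qed.

Lemma measurable_fibre_part S T i0 f : S \subset T ->
  measurable_for (facet_restr T) f ->
  measurable_for (facet_restr T) (fibre_part S i0 f).
Proof.
by move=> ST mf i j e; rewrite !mxE (mf _ _ e) (facet_restr_coarser ST e).
Qed.

Lemma sum_facets_fibre S i0 (F : {set V} -> R) :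
  \sum_(w in facets X | restr X w S == facet_restr S i0) pi w * F w
  = \sum_(i | facet_restr S i == facet_restr S i0) mu i 0 * F (enum_val i).
Proof.
rewrite big_enum_val_cond.
by apply: eq_bigr => i _; rewrite mxE.
Qed.

(** * Transfer between a link and the facets through its face *)

Section Fibre.
Variables (S : {set 'I_n}) (i0 : 'I_N).
Local Notation a := (facet_restr S i0).
Local Notation mua := (fibre_distr S i0).
Local Notation mass := (prob X pi (fun w => restr X w S == a)).

Let i0X : enum_val i0 \in facets X := enum_valP i0.

Let mass_gt0 : 0 < mass := fibre_prob_gt0 hpi S i0X.

Lemma wnorm_link T (F : {set V} -> R) :
  wnorm (link_distr X pi a T) (\col_i F (enum_val i))
  = wnorm mua (\col_i F (facet_restr T i)) / Num.sqrt mass.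
Proof.
rewrite /wnorm inner_link// -(sqrtrV (ltW mass_gt0)) -sqrtrM; last first.
  exact/inner_ge0/fibre_distr_ge0.
congr (Num.sqrt (_ / _)); rewrite inner_fibreE.
under eq_bigr do rewrite -mulrA.
rewrite (sum_facets_fibre S i0 (fun w => F (restr X w T) * F (restr X w T))).
by apply: eq_bigr => i _; rewrite !mxE mulrA.
Qed.

Lemma inner_link1 T (F : {set V} -> R) :
  inner (link_distr X pi a T) (\col_i F (enum_val i)) (const_mx 1)
  = inner mua (\col_i F (facet_restr T i)) (const_mx 1) / mass.
Proof.
transitivity (\sum_i link_distr X pi a T i 0 * F (enum_val i)).
  by apply: eq_bigr => i _; rewrite !mxE mulr1.
rewrite link_expectation// inner_fibreE; congr (_ / _).
rewrite (sum_facets_fibre S i0 (fun w => F (restr X w T))).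
by apply: eq_bigr => i _; rewrite !mxE mulr1.
Qed.

Lemma inner_walk I J (F G : {set V} -> R) : [disjoint S & I] ->
  inner (link_distr X pi a I) (\col_i F (enum_val i))
    (colored_walk X pi a I J *m \col_j G (enum_val j))
  = inner mua (\col_i F (facet_restr I i)) (\col_i G (facet_restr J i)) / mass.
Proof.
move=> dSI; rewrite inner_colored_walk// inner_fibreE; congr (_ / _).
under eq_bigr do rewrite -mulrA.
rewrite (sum_facets_fibre S i0 (fun w => F (restr X w I) * G (restr X w J))).
by apply: eq_bigr => i _; rewrite !mxE mulrA.
Qed.

(** Cauchy-Schwarz on the fibre. It supplies the a priori bound with constant 1 that
    [inner_le_sigma2] and [sigma2_le] ask for. *)
Lemma walk_contraction I J (f : 'cV_#|link X a I|) (g : 'cV_#|link X a J|) :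
  [disjoint S & I] ->
  inner (link_distr X pi a I) f (colored_walk X pi a I J *m g)
  <= 1 * wnorm (link_distr X pi a I) f * wnorm (link_distr X pi a J) g.
Proof.
move=> dSI; have [F ->] := cV_enum_val f; have [G ->] := cV_enum_val g.
rewrite inner_walk// !wnorm_link mul1r mulf_div -expr2 (sqr_sqrtr (ltW mass_gt0)).
rewrite ler_pM2r ?invr_gt0//; exact/inner_le_wnorm/fibre_distr_ge0.
Qed.

Lemma sigma2_walk_le1 I J : [disjoint S & I] -> sigma2_walk X pi a I J <= 1.
Proof.
by move=> dSI; apply: sigma2_le => // f g _ _; apply: walk_contraction.
Qed.

(** On the fibre the coordinates in [S] are frozen, so [f] depends on those in [T] alone. *)
Lemma measurable_factor T f : measurable_for (facet_restr (S :|: T)) f ->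
  exists F : {set V} -> R, forall i, facet_restr S i = a ->
    F (facet_restr T i) = f i 0.
Proof.
move=> mf; exists (fun t => if [pick i | (facet_restr S i == a)
   && (facet_restr T i == t)] is Some i then f i 0 else 0) => i iS.
case: pickP => [j /andP[/eqP jS /eqP jT]|/(_ i)]; last by rewrite iS !eqxx.
by apply: mf; move: iS jS jT; rewrite /facet_restr !restrU => -> -> ->.
Qed.

Lemma inner_le_sigma2_walk I J g h : [disjoint S & I] ->
  measurable_for (facet_restr (S :|: I)) g ->
  measurable_for (facet_restr (S :|: J)) h ->
  inner mua g (const_mx 1) = 0 -> inner mua h (const_mx 1) = 0 ->
  inner mua g h <= sigma2_walk X pi a I J * wnorm mua g * wnorm mua h.
Proof.
move=> dSI /measurable_factor[G GE] /measurable_factor[H HE] g0 h0.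
have cs := inner_CS (fibre_distr_ge0 S i0) g h.
(* Vectors of norm zero cannot be normalised; Cauchy-Schwarz settles them. *)
have null : inner mua g g * inner mua h h = 0 -> inner mua g h = 0.
  by move=> e; apply/eqP; rewrite -sqrf_eq0 eq_le sqr_ge0 -e cs.
have [gn0|gn0] := eqVneq (wnorm mua g) 0.
  rewrite gn0 mulr0 mul0r null// -(sqr_wnorm (fibre_distr_ge0 S i0) g) gn0.
  by rewrite expr0n mul0r.
have [hn0|hn0] := eqVneq (wnorm mua h) 0.
  rewrite hn0 mulr0 null// -(sqr_wnorm (fibre_distr_ge0 S i0) h) hn0.
  by rewrite expr0n mulr0.
pose g' : 'cV[R]_N := \col_i G (facet_restr I i).
pose h' : 'cV[R]_N := \col_i H (facet_restr J i).
have inE f1 f2 f1' f2' : (forall i, facet_restr S i = a -> f1 i 0 = f1' i 0) ->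
    (forall i, facet_restr S i = a -> f2 i 0 = f2' i 0) ->
    inner mua f1 f2 = inner mua f1' f2'.
  move=> e1 e2; rewrite !inner_fibreE; apply: eq_bigr => i /eqP ia.
  by rewrite e1// e2.
have gg' i : facet_restr S i = a -> g i 0 = g' i 0 by move=> ia; rewrite mxE GE.
have hh' i : facet_restr S i = a -> h i 0 = h' i 0 by move=> ia; rewrite mxE HE.
have wg : wnorm mua g = wnorm mua g' by congr Num.sqrt; apply: inE.
have wh : wnorm mua h = wnorm mua h' by congr Num.sqrt; apply: inE.
have smass : 0 < Num.sqrt mass by rewrite sqrtr_gt0.
have := @inner_le_sigma2 R _ _ (link_distr X pi a I) (link_distr X pi a J)
  (colored_walk X pi a I J) 1 (fun x y _ _ => walk_contraction x y dSI)
  (\col_i G (enum_val i)) (\col_i H (enum_val i)).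
rewrite !inner_link1 !wnorm_link inner_walk// -/g' -/h' -wg -wh.
have cE i : facet_restr S i = a ->
  (const_mx 1 : 'cV[R]_N) i 0 = (const_mx 1 : 'cV[R]_N) i 0 by [].
rewrite -(inE _ _ _ _ gg' cE) -(inE _ _ _ _ hh' cE).
rewrite -(inE _ _ _ _ gg' hh') g0 h0 !mul0r.
rewrite !mulf_eq0 !invr_eq0 !negb_or gn0 hn0 gt_eqF// => /(_ erefl erefl isT isT).
rewrite -/(sigma2_walk X pi a I J) -mulrA mulf_div -expr2 (sqr_sqrtr (ltW mass_gt0)).
by rewrite !mulrA ler_pM2r ?invr_gt0.
Qed.

End Fibre.

(** On each fibre over [S] both [f] and its projection [h] have mean zero, and the squared norm of
    [h] is [inner m f h], at most [c] times the product of their norms. Divide by the norm of [h]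
    and sum over fibres. *)
Lemma condexp_walk_le S I J c f :
  [disjoint S & I] -> 0 <= c ->
  (forall w, w \in facets X -> sigma2_walk X pi (restr X w S) I J <= c) ->
  measurable_for (facet_restr (S :|: I)) f ->
  E S f = 0 ->
  inner mu (E (S :|: J) f) (E (S :|: J) f) <= c ^+ 2 * inner mu f f.
Proof.
move=> dSI c0 cP mf Ef; set h := E (S :|: J) f.
have mh : measurable_for (facet_restr (S :|: J)) h by exact: measurable_condexp.
rewrite /inner (partition_big (facet_restr S) predT)//=.
rewrite [X in _ <= _ * X](partition_big (facet_restr S) predT)//= mulr_sumr.
apply: ler_sum => a _.
have [/existsP[i0 /eqP i0a]|/existsPn none] := boolP [exists i, facet_restr S i == a];
  last first.
  by rewrite !big_pred0 ?mulr0// => i; apply/negbTE.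
rewrite -{}i0a -!inner_fibreE; set m := fibre_distr S i0.
have m_ge0 i : 0 <= m i 0 by exact: fibre_distr_ge0.
have SJ : S \subset S :|: J by exact: subsetUl.
have fh : inner m f h = inner m h h.
  rewrite innerC !inner_fibre /h inner_condexp//.
  exact: measurable_fibre_part.
have m1 T : S \subset T ->
    measurable_for (facet_restr T) (fibre_part S i0 (const_mx 1)).
  by move=> ST; apply: measurable_fibre_part => // i j _; rewrite !mxE.
have part1 : inner mu (fibre_part S i0 (const_mx 1)) f = 0.
  by rewrite -(inner_condexp mu_gt0 _ (m1 S _))// Ef -(scale0r 0) innerZr mul0r.
have f1 : inner m f (const_mx 1) = 0 by rewrite innerC inner_fibre.
have h1 : inner m h (const_mx 1) = 0.
  by rewrite innerC inner_fibre /h inner_condexp//; apply: m1.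
have := inner_le_sigma2_walk dSI mf mh f1 h1; rewrite fh => le1.
have {}le1 : inner m h h <= c * wnorm m f * wnorm m h.
  apply: le_trans le1 _; rewrite -!mulrA ler_wpM2r ?mulr_ge0 ?sqrtr_ge0//.
  exact/cP/enum_valP.
rewrite -!(sqr_wnorm m_ge0) in le1 *.
have [->|h0] := eqVneq (wnorm m h) 0.
  by rewrite expr0n mulr_ge0 ?sqr_ge0.
rewrite expr2 ler_pM2r in le1; last by rewrite lt_def h0 sqrtr_ge0.
by rewrite -exprMn ler_sqr// nnegrE ?mulr_ge0 ?sqrtr_ge0.
Qed.

(** An operator and its adjoint have the same norm: with [h'] the projection of [h] back, the
    squared norm of [h] is [inner mu g h'], and Cauchy-Schwarz applies. *)
Lemma condexp_walk_dual S I J d g : 0 <= d ->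
  (forall f, measurable_for (facet_restr (S :|: J)) f ->
    E S f = 0 ->
    inner mu (E (S :|: I) f) (E (S :|: I) f) <= d * inner mu f f) ->
  measurable_for (facet_restr (S :|: I)) g ->
  E S g = 0 ->
  inner mu (E (S :|: J) g) (E (S :|: J) g) <= d * inner mu g g.
Proof.
move=> d0 H mg Eg; set h := E (S :|: J) g.
have mh : measurable_for (facet_restr (S :|: J)) h by exact: measurable_condexp.
have Eh : E S h = 0.
  by rewrite /h condexp_tower//; apply/facet_restr_coarser/subsetUl.
have := H h mh Eh; set h' := condexp _ _ h => /= le1.
have hE : inner mu h h = inner mu g h'.
  by rewrite /h' inner_condexp// [RHS]innerC /h inner_condexp_self.
have := inner_CS mu_ge0 g h'; rewrite -hE => le2.
have h0 := inner_ge0 mu_ge0 h; have g0 := inner_ge0 mu_ge0 g.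
have [->|hn0] := eqVneq (inner mu h h) 0; first by rewrite mulr_ge0.
rewrite -(@ler_pM2r _ (inner mu h h)) ?lt_def ?hn0// -expr2.
apply: le_trans le2 _; rewrite mulrC -mulrA [inner mu g g * _]mulrC mulrA.
exact: ler_wpM2r.
Qed.

Lemma facet_exists : exists w, w \in facets X.
Proof.
apply/set0Pn/eqP => X0; have [_] := hpi; rewrite X0 big_set0 => /esym/eqP.
by rewrite oner_eq0.
Qed.

(** * Variance decay when coordinates are revealed one at a time *)

Section EpsProduct.
Variable eps : nat -> R.
Hypothesis eps_le1 : forall k, (k.+2 <= n)%N -> eps k <= 1.
Hypothesis epsP : eps_product X pi eps.

Lemma sigma2_walk_le_eps w S i j : w \in facets X -> i != j ->
  i \notin S -> j \notin S ->
  sigma2_walk X pi (restr X w S) [set i] [set j] <= eps #|S|.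
Proof.
move=> wX ij iS jS; rewrite -(card_restr wX S).
apply: epsP; rewrite ?typ_restr ?restr_face// card_restr//.
have := max_card (mem (i |: (j |: S))).
by rewrite card_ord !cardsU1 !inE negb_or ij iS jS.
Qed.

(** The lower bound comes from an actual walk: the part of a facet on the first [k] sides, with the
    next two sides as [i] and [j]. *)
Lemma eps_range k : (k.+2 <= n)%N -> 0 <= eps k <= 1.
Proof.
move=> kn; rewrite eps_le1// andbT; have [w wX] := facet_exists.
pose i := Ordinal (ltnW kn : (k < n)%N); pose j := Ordinal (kn : (k.+1 < n)%N).
pose S := [set x : 'I_n | (x < k)%N].
have cS : #|S| = k.
  rewrite -sum1_card (eq_bigl (fun x : 'I_n => (x < k)%N)); last first.
    by move=> x; rewrite inE.
  by rewrite (big_ord_narrow (ltnW (ltnW kn))) /= sum1_card card_ord.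
have iS : i \notin S by rewrite inE ltnn.
have jS : j \notin S by rewrite inE /= ltnNge leqnSn.
have ij : i != j by rewrite -val_eqE /= neq_ltn ltnSn.
have := sigma2_walk_le_eps wX ij iS jS; rewrite cS; apply: le_trans.
exact: sigma2_ge0.
Qed.

Lemma sqr_eps_range k : (k.+2 <= n)%N -> 0 <= 1 - eps k ^+ 2 <= 1.
Proof. by move=> /eps_range/andP[e0 e1]; apply/andP; split; nra. Qed.

Lemma prod_eps_range k m : (k + m.+1 <= n)%N ->
  0 <= \prod_(0 <= p < m) (1 - eps (k + p)%N ^+ 2) <= 1.
Proof.
move=> kmn; rewrite big_seq; apply: (big_ind (fun x => 0 <= x <= 1)).
- by rewrite ler01 lexx.
- by move=> x y /andP[x0 x1] /andP[y0 y1]; rewrite mulr_ge0//= mulr_ile1.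
- move=> p; rewrite mem_index_iota => /andP[_ pm]; apply: sqr_eps_range.
  by apply: leq_trans kmn; rewrite -!addnS leq_add2l.
Qed.

(** The squared norm of [f - E T f] is the mean conditional variance given [T]. Reveal one [i] of
    [I], which costs the factor of index [#|S|], and apply induction with [i |: S] in place of
    [S]. *)
Lemma eps_product_chain m S I j f :
  #|I| = m -> [disjoint S & I] -> j \notin S -> j \notin I ->
  measurable_for (facet_restr (S :|: [set j])) f ->
  (\prod_(0 <= p < m) (1 - eps (#|S| + p)%N ^+ 2)) * inner mu (f - E S f) (f - E S f)
    <= inner mu (f - E (S :|: I) f) (f - E (S :|: I) f).
Proof.
elim: m S I => [|m IH] S I cI dSI jS jI mf.
  by rewrite big_geq// mul1r (cards0_eq cI) setU0.
pose d T := f - E T f; rewrite -/(d S) -/(d (S :|: I)).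
have /card_gt0P[i iI] : (0 < #|I|)%N by rewrite cI.
have iS : i \notin S by rewrite (disjointFl dSI).
have ij : i != j by apply: contraNneq jI => <-.
have bound : (#|S| + m.+2 <= n)%N.
  have := max_card (mem (j |: (S :|: I))).
  rewrite card_ord cardsU1 inE negb_or jS jI cardsU (disjoint_setI0 dSI) cards0.
  by rewrite cI subn0 add1n !addnS.
have cS' : #|i |: S| = #|S|.+1 by rewrite cardsU1 iS.
have SI : (i |: S) :|: (I :\ i) = S :|: I.
  by rewrite [i |: S]setUC -setUA setD1K.
have {}IH : (\prod_(0 <= p < m) (1 - eps (#|S|.+1 + p)%N ^+ 2))
    * inner mu (d (i |: S)) (d (i |: S)) <= inner mu (d (S :|: I)) (d (S :|: I)).
  rewrite -SI -cS'; apply: IH.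
  - by have := cardsD1 i I; rewrite iI cI => -[].
  - apply/pred0P => x; have := pred0P dSI x; rewrite /= !inE.
    by case: eqVneq => //= _; rewrite ?andbF.
  - by rewrite !inE negb_or eq_sym ij.
  - by rewrite !inE (negPf jI) andbF.
  - apply: measurable_coarser mf => x y.
    by apply: facet_restr_coarser; rewrite -setUA subsetUr.
apply: le_trans IH; rewrite big_nat_recl// addn0.
under eq_bigr do rewrite addnS -addSn.
rewrite -mulrA mulrCA; apply: ler_wpM2l.
  have bound' : (#|S|.+1 + m.+1 <= n)%N by rewrite addSn -addnS.
  by have /andP[] := prod_eps_range bound'.
have kn : (#|S|.+2 <= n)%N.
  by apply: leq_trans bound; rewrite !addnS !ltnS leq_addr.
have /andP[e0 e1] := eps_range kn.
(* [h] is the part of the variance explained by [i], and [f0 - h] is what remains. The walk from [j]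
   to [i] bounds [h]. *)
set f0 := d S; pose h := E (S :|: [set i]) f0.
have SSi : S \subset S :|: [set i] by exact: subsetUl.
have hE : h = E (S :|: [set i]) f - E S f.
  by rewrite /h condexpB condexp_finer//; apply: facet_restr_coarser.
have dE : f0 - h = d (i |: S).
  by rewrite hE /f0 /d [i |: S]setUC opprB addrA subrK.
have dSj : [disjoint S & [set j]] by rewrite disjoint_sym disjoints1.
have mf0 : measurable_for (facet_restr (S :|: [set j])) f0.
  move=> x y e; rewrite !mxE (mf _ _ e).
  by rewrite (facet_restr_coarser (subsetUl S [set j]) e).
have Ef0 : E S f0 = 0.
  rewrite condexpB [X in _ - X]condexp_id ?subrr//; exact: measurable_condexp.
have := condexp_walk_le (J := [set i]) dSj e0
  (fun w wX => sigma2_walk_le_eps wX (_ : j != i) jS iS) mf0 Ef0.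
rewrite eq_sym => /(_ ij) /=; rewrite -/h => le1.
have := condexp_pythagoras mu_gt0 (facet_restr (S :|: [set i])) f0.
rewrite -/h dE; lra.
Qed.

End EpsProduct.
End Walks.

(** Extend the face to a maximal one, a facet by purity; its part of type [typ X a] contains [a] and
    has no more vertices. *)
Lemma face_eq_restr (V : finType) (n : nat) (X : partiteComplex V n) (a : {set V}) :
  a \in faces X -> exists2 w, w \in facets X & restr X w (typ X a) = a.
Proof.
move=> aX; have [w mw aw] := @maxset_exists _ (fun b => b \in faces X) a aX.
have wX : w \in facets X.
  by have /= wf := maxsetp mw; rewrite inE wf /=; apply/eqP; apply: faces_pure mw.
exists w => //; apply/eqP; rewrite eq_sym eqEcard card_restr// leq_imset_card andbT.
by apply/subsetP => v va; rewrite inE (subsetP aw)//=; apply: imset_f.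
Qed.

(** * The sweep *)

Section Sweep.
Variables (R : realType) (V : finType) (n : nat) (X : partiteComplex V n).
Variables (pi : {set V} -> R) (hpi : is_weight X pi).
Implicit Types (S I J T : {set 'I_n}) (f g h : 'cV[R]_#|facets X|).
Local Notation mu := (facet_distr X pi).
Local Notation E T f := (condexp mu (@facet_restr _ _ X T) f).

Lemma sigma2_walk_le_eps_walk I J w : w \in facets X ->
  sigma2_walk X pi (restr X w (~: (I :|: J))) I J <= eps_walk X pi I J.
Proof.
move=> wX; apply: (le_bigmax_cond _ (fun a => sigma2_walk X pi a I J)).
exact: restr_faces_typ.
Qed.

Lemma eps_walk_ge0 I J : 0 <= eps_walk X pi I J.
Proof. exact: bigmax_ge_id. Qed.

Lemma eps_walk_le1 I J : eps_walk X pi I J <= 1.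
Proof.
apply: bigmax_le => // a; rewrite inE => /andP[/face_eq_restr[w wX wa] /eqP ta].
rewrite -wa -(enum_rankK_in wX wX); apply: sigma2_walk_le1 => //.
by rewrite ta disjoint_sym disjoints_subset setCK subsetUl.
Qed.

Lemma update_condexp i f : update X pi i *m f = E (~: [set i]) f.
Proof.
apply/colP => x; rewrite !mxE mulr_suml [RHS]big_mkcond; apply: eq_bigr => y _.
have xX := enum_valP x; have yX := enum_valP y.
rewrite !mxE /update_entry /facet_restr; case: ifP => [/eqP yx|_];
  last by rewrite mul0r.
rewrite mulrAC /cond_marginal typ_restr//; congr (_ * _ / _).
(* A facet is determined by its vertex on side [i] together with the others, so the numerator is the
   weight of one facet. *)
- rewrite /prob (big_pred1 (enum_val y))// => w /=.
  rewrite -yx andbC; apply/idP/idP; last first.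
    by move=> /eqP->; rewrite !eqxx yX.
  move=> /andP[/andP[/eqP e1 /eqP e2] wX]; rewrite -[w](restr_setT X).
  by rewrite -(setUCr [set i]) restrU e1 e2 -restrU setUCr restr_setT.
- rewrite /prob big_enum_val_cond/=.
  by apply: eq_bigr => z _; rewrite mxE.
Qed.

Variable s : {perm 'I_n}.

(** Reduces both estimates to one inequality per position: [L k] keeps all coordinates but [s k],
    and [A k] those not yet updated, from all of them at 0 to none at [n]. *)
Lemma sweep_bound (e : nat -> R) :
  (forall k : 'I_n, 0 <= e k <= 1) ->
  (forall (k : 'I_n) g, measurable_for (@facet_restr _ _ X (~: [set s k])) g ->
     E (~: (before s k :|: [set s k])) g = 0 ->
     inner mu (E (~: before s k) g) (E (~: before s k) g)
       <= (1 - e k) * inner mu g g) ->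
  [/\ 0 <= sigma2_facets pi (sweep X pi s),
      0 <= 1 - \prod_(k < n) e k
    & sigma2_facets pi (sweep X pi s) <= Num.sqrt (1 - \prod_(k < n) e k)].
Proof.
move=> e01 Hang.
have mu_gt0 := facet_distr_gt0 hpi.
have mu_ge0 i : 0 <= mu i 0 by exact: ltW.
(* [bef], [pt] and [Q] extend the data to all natural positions, since [A] is also evaluated at
   [n]. *)
pose bef k := [set s a | a : 'I_n & (a < k)%N].
pose pt k := [set x | s^-1%g x == k :> nat].
have in_bef k x : (x \in bef k) = (s^-1%g x < k)%N.
  apply/imsetP/idP => [[y]|xk]; first by rewrite inE => yk ->; rewrite permK.
  by exists (s^-1%g x); rewrite ?inE ?permKV.
have ptE (k : 'I_n) : pt k = [set s k].
  by apply/setP => x; rewrite !inE val_eqE (can2_eq (permKV s) (permK s)).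
have befS k : bef k.+1 = bef k :|: pt k.
  by apply/setP => x; rewrite in_setU !in_bef inE ltnS leq_eqVlt orbC.
pose Q k : 'M[R]_#|facets X| :=
  if insub k is Some k' then update X pi (s k') else 1%:M.
have QE (k : 'I_n) : Q k = update X pi (s k) by rewrite /Q valK.
have sweepE : sweep X pi s = \big[mulmx/1%:M]_(k < n) Q k.
  by apply: eq_bigr => k _; rewrite QE.
pose L k := @facet_restr _ _ X (~: pt k).
pose A k := @facet_restr _ _ X (~: bef k).
have e01' k (kn : (k < n)%N) : 0 <= e k <= 1 := e01 (Ordinal kn).
pose p := \prod_(k < n) e k.
have p01 : 0 <= p <= 1.
  apply: (big_ind (fun x => 0 <= x <= 1)) => //; first by rewrite ler01 lexx.
  by move=> x y /andP[x0 x1] /andP[y0 y1]; rewrite mulr_ge0//= mulr_ile1.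
have {}p01 : 0 <= 1 - p by rewrite subr_ge0; case/andP: p01.
have bound f : E set0 f = 0 ->
    inner mu (sweep X pi s *m f) (sweep X pi s *m f) <= (1 - p) * inner mu f f.
  move=> Ef; rewrite sweepE; apply: (product_condexp_bound mu_gt0 (L := L) (A := A)).
  - by move=> k g kn; rewrite (QE (Ordinal kn)) update_condexp /L (ptE (Ordinal kn)).
  - have bef0 : bef 0 = set0 by apply/setP => x; rewrite in_bef inE.
    by move=> x y; rewrite /A bef0 setC0 /facet_restr !restr_setT => /enum_val_inj.
  - by move=> k x y kn; apply: facet_restr_coarser; rewrite setCS befS subsetUl.
  - by move=> k x y kn; apply: facet_restr_coarser; rewrite setCS befS subsetUr.
  - by [].
  - move=> k g kn mg Eg; apply: (Hang (Ordinal kn)).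
      by rewrite -(ptE (Ordinal kn)).
    by rewrite -(ptE (Ordinal kn)) -befS.
  - suff -> : A n = facet_restr set0 by [].
    rewrite /A; suff -> : bef n = setT by rewrite setCT.
    by apply/setP => x; rewrite in_bef inE ltn_ord.
have mean0 f : inner mu f (const_mx 1) = 0 -> E set0 f = 0.
  move=> f0; apply/colP => x; rewrite !mxE.
  rewrite (eq_bigl predT); last by move=> y; rewrite /facet_restr !restr_set0 eqxx.
  suff -> : \sum_j mu j 0 * f j 0 = inner mu f (const_mx 1) by rewrite f0 mul0r.
  by apply: eq_bigr => j _; rewrite !mxE mulr1.
have cs f g : inner mu f (const_mx 1) = 0 -> inner mu g (const_mx 1) = 0 ->
    inner mu f (sweep X pi s *m g)
    <= Num.sqrt (1 - p) * wnorm mu f * wnorm mu g.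
  move=> _ /mean0/bound g0; apply: le_trans (inner_le_wnorm mu_ge0 _ _) _.
  rewrite [Num.sqrt _ * _]mulrC -mulrA ler_wpM2l ?sqrtr_ge0//.
  by rewrite -sqrtrM// ler_sqrt// mulr_ge0// inner_ge0.
split=> //; first exact: sigma2_ge0.
by apply: (sigma2_le cs); exact: sqrtr_ge0.
Qed.

Lemma sqr_bound_of_sqrt_bound (x b : R) : [/\ 0 <= x, 0 <= b & x <= Num.sqrt b] ->
  x ^+ 2 <= b /\ 1 - Num.sqrt b <= 1 - x.
Proof.
move=> [x0 b0 xb]; split; last by rewrite lerD2l lerN2.
by rewrite -(sqr_sqrtr b0) ler_sqr ?nnegrE ?sqrtr_ge0.
Qed.

Lemma before_disjoint (k : 'I_n) :
  [disjoint ~: (before s k :|: [set s k]) & before s k].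
Proof. by rewrite disjoint_sym disjoints_subset setCK subsetUl. Qed.

Lemma notin_before (k : 'I_n) : s k \notin before s k.
Proof.
apply/imsetP => -[y]; rewrite inE => yk /perm_inj ky.
by rewrite ky ltnn in yk.
Qed.

(** With the complement of the first [k.+1] updated coordinates as [S], these unions are the keys
    [S :|: I] and [S :|: J] of the walk lemmas. *)
Lemma setC_before (k : 'I_n) :
  ~: (before s k :|: [set s k]) :|: before s k = ~: [set s k] /\
  ~: (before s k :|: [set s k]) :|: [set s k] = ~: before s k.
Proof.
have nk := notin_before k.
split; apply/setP => x; rewrite !inE; have [->|] := eqVneq x (s k);
  rewrite ?(negPf nk)//=; case: (x \in before s k) => //.
Qed.

Lemma card_before (k : 'I_n) : #|before s k| = k.
Proof.
rewrite card_imset; last exact: perm_inj.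
rewrite -sum1_card (eq_bigl (fun x : 'I_n => (x < k)%N)); last first.
  by move=> x; rewrite inE.
by rewrite (big_ord_narrow (ltnW (ltn_ord k))) /= sum1_card card_ord.
Qed.

Lemma sweep_eps_walk_bound :
  let b := 1 - \prod_(k < n | (0 < k)%N)
                 (1 - eps_walk X pi (before s k) [set s k] ^+ 2) in
  sigma2_facets pi (sweep X pi s) ^+ 2 <= b /\
  1 - Num.sqrt b <= Gap pi (sweep X pi s).
Proof.
(* Position 0 gets the factor 1, because the product starts at the second position. *)
pose e k := if insub k is Some k' then
  if (0 < k)%N then 1 - eps_walk X pi (before s k') [set s k'] ^+ 2 else 1 else 1.
have eE (k : 'I_n) : e k =
    if (0 < k)%N then 1 - eps_walk X pi (before s k) [set s k] ^+ 2 else 1.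
  by rewrite /e valK.
apply: sqr_bound_of_sqrt_bound.
rewrite big_mkcond /=; under eq_bigr do rewrite -eE.
apply: sweep_bound => [k|k g mg Eg]; rewrite eE; case: ifPn => k0.
- have := eps_walk_ge0 (before s k) [set s k].
  have := eps_walk_le1 (before s k) [set s k].
  move: (eps_walk _ _ _ _) => x x1 x0; apply/andP; split; nra.
- by rewrite ler01 lexx.
- rewrite subKr.
  have [eI eJ] := setC_before k.
  have := condexp_walk_le hpi (before_disjoint k)
    (eps_walk_ge0 (before s k) [set s k]) (J := [set s k])
    (fun w wX => sigma2_walk_le_eps_walk (before s k) [set s k] wX) _ Eg.
  by rewrite eI eJ; apply.
(* At position 0 the factor 1 demands a zero projection: [g] is measurable for the key on which its
   conditional expectation vanishes, so it is zero. *)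
- have k00 : k = 0%N :> nat by case: (nat_of_ord k) k0.
  have b0 : before s k = set0 by apply: cards0_eq; rewrite card_before.
  have g0 : g = 0.
    by rewrite -Eg b0 set0U condexp_id//; apply: facet_distr_gt0.
  apply: le_trans (condexp_contraction (facet_distr_gt0 hpi) _ _) _.
  by rewrite g0 -(scale0r 0) !innerZl !mul0r mulr0.
Qed.

Lemma sweep_eps_product_bound (eps : nat -> R) :
  (forall k, (k.+2 <= n)%N -> eps k <= 1) -> eps_product X pi eps ->
  let b := 1 - \prod_(2 <= j < n.+1) \prod_(0 <= p < j.-1)
                 (1 - eps (n - j + p)%N ^+ 2) in
  sigma2_facets pi (sweep X pi s) ^+ 2 <= b /\
  1 - Num.sqrt b <= Gap pi (sweep X pi s).
Proof.
move=> eps_le1 epsP.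
(* Here [j = k.+1], and [n - k.+1] is the number of coordinates outside the first [k.+1]; [e 0] is
   an empty product. *)
pose e k := \prod_(0 <= p < k) (1 - eps (n - k.+1 + p)%N ^+ 2).
apply: sqr_bound_of_sqrt_bound.
have -> : \prod_(2 <= j < n.+1) \prod_(0 <= p < j.-1) (1 - eps (n - j + p)%N ^+ 2)
    = \prod_(k < n) e k.
  rewrite big_add1 /= -(big_mkord predT e); case: (posnP n) => [n0|n0].
    by rewrite [RHS]big_geq ?n0// big_geq.
  by rewrite [RHS]big_ltn// [e 0]big_geq// mul1r.
have e01 (k : 'I_n) : 0 <= e k <= 1.
  by apply: (prod_eps_range hpi eps_le1 epsP); rewrite addnC subnKC.
apply: sweep_bound => // k g mg Eg.
have [eI eJ] := setC_before k.
rewrite -eJ; set S := ~: _ in Eg eI eJ *.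
have d0 : 0 <= 1 - e k by rewrite subr_ge0; case/andP: (e01 k).
have cS : #|S| = (n - k.+1)%N.
  by rewrite cardsCs setCK card_ord setUC cardsU1 notin_before card_before.
(* The chain controls functions of the single coordinate [s k] given [S], whereas [sweep_bound] asks
   about functions of the coordinates before it; duality exchanges the two. *)
apply: (condexp_walk_dual hpi (I := before s k)) => //; last by rewrite eI.
move=> f mf Ef.
have skS : s k \notin S by rewrite !inE eqxx orbT.
have := eps_product_chain hpi eps_le1 epsP (card_before k) (before_disjoint k)
  skS (notin_before k) mf.
rewrite cS -/(e k) Ef subr0.
have := condexp_pythagoras (facet_distr_gt0 hpi) (facet_restr (S :|: before s k)) f.
by rewrite -/S; lra.
Qed.

End Sweep.

Theorem theorem3p1 (R : realType) (V : finType) (n : nat)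
    (X : partiteComplex V n) (pi : {set V} -> R) (hpi : is_weight X pi)
    (s : {perm 'I_n}) :
  [/\ sigma2_facets pi (sweep X pi s) ^+ 2
        <= 1 - \prod_(k < n | (0 < k)%N)
                 (1 - eps_walk X pi (before s k) [set s k] ^+ 2),
      1 - Num.sqrt (1 - \prod_(k < n | (0 < k)%N)
                          (1 - eps_walk X pi (before s k) [set s k] ^+ 2))
        <= Gap pi (sweep X pi s)
    & forall eps : nat -> R,
        (forall k : nat, (k.+2 <= n)%N -> eps k <= 1) ->
        eps_product X pi eps ->
        sigma2_facets pi (sweep X pi s) ^+ 2
          <= 1 - \prod_(2 <= j < n.+1) \prod_(0 <= p < j.-1)
                   (1 - eps (n - j + p)%N ^+ 2)
        /\ 1 - Num.sqrt (1 - \prod_(2 <= j < n.+1) \prod_(0 <= p < j.-1)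
                               (1 - eps (n - j + p)%N ^+ 2))
             <= Gap pi (sweep X pi s)].
Proof.
have [sigma2_le gap_ge] := sweep_eps_walk_bound hpi s.
by split=> // eps; apply: sweep_eps_product_bound.
Qed.
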